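(* Let $p\ge3$, let $f=f(x_1,\dots,x_p)$ be a smooth function, and let $(M,g_f)=(\mathbb{R}^{2p},g_f)$ be as defined in the context, with Hessian $H=(\partial_{x_i}\partial_{x_j}f)$. Let $P\in M$. (1) If $H(P)$ is definite, then for every non-null $x\in T_PM$, $J_W(x)$ has rank $p-1$ and $J_W(x)^2=0$. In particular, if $H$ is definite at every point, $(M,g_f)$ is conformally spacelike and conformally timelike Jordan Osserman. (2) If $H(P)$ is indefinite, then $(M,g_f)$ is neither conformally spacelike Jordan Osserman nor conformally timelike Jordan Osserman. (3) If $H(P)$ is non-degenerate, then for every oriented spacelike or timelike 2-plane $\pi\subset T_PM$, $W(\pi)$ has rank $2$ and $W(\pi)^2=0$. In particular, if $H$ is non-degenerate at every point, $(M,g_f)$ is conformally spacelike and conformally timelike Jordan Ivanov-Petrova.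
   Context: On $\mathbb{R}^{2p}$ with coordinates $(x_1,\dots,x_p,y_1,\dots,y_p)$ and a smooth $f=f(x_1,\dots,x_p)$, the neutral signature metric $g_f$ is defined by $g_f(\partial_{x_i},\partial_{x_j})=\partial_{x_i}f\cdot\partial_{x_j}f$, $g_f(\partial_{x_i},\partial_{y_j})=g_f(\partial_{y_j},\partial_{x_i})=\delta_{ij}$, $g_f(\partial_{y_i},\partial_{y_j})=0$. For a pseudo-Riemannian manifold of dimension $m\ge3$ with curvature 4-tensor $R$, Ricci tensor $\rho(x,y)=\sum_{ij}g^{ij}R(x,e_i,e_j,y)$, scalar curvature $\tau=\sum g^{ij}\rho(e_i,e_j)$, the Weyl tensor is $W(x,y,z,w)=R(x,y,z,w)-\frac1{m-2}\{\rho(x,w)g(y,z)+g(x,w)\rho(y,z)\}+\frac1{m-2}\{\rho(x,z)g(y,w)+g(x,z)\rho(y,w)\}+\frac{\tau}{(m-1)(m-2)}\{g(x,w)g(y,z)-g(x,z)g(y,w)\}$. The Jacobi operator: $g(J_W(x)y,z)=W(y,x,x,z)$. For an oriented spacelike or timelike 2-plane $\pi$ with oriented orthonormal basis $\{e_1,e_2\}$, $g(W(\pi)x,y)=W(e_1,e_2,x,y)$. Conformally spacelike (resp. timelike) Jordan Osserman: at each point $P$, the Jordan normal form of $J_{W_P}(x)$ is constant for $x$ with $g(x,x)=1$ (resp. $-1$). Conformally spacelike (resp. timelike) Jordan Ivanov-Petrova: at each point $P$, the Jordan normal form of $W_P(\pi)$ is constant over oriented spacelike (resp. timelike) 2-planes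 $\pi\subset T_PM$. (The Jordan normal form may vary with $P$.) *)

(* Defs.v *)
From HB Require Import structures.
From mathcomp Require Import all_boot all_order all_algebra.
From mathcomp Require Import mxred.
From mathcomp Require Import all_classical all_reals all_analysis.
Set Implicit Arguments.
Unset Strict Implicit.
Unset Printing Implicit Defensive.
Import Order.TTheory GRing.Theory Num.Theory.
Import numFieldNormedType.Exports.
Local Open Scope ring_scope.

(* Points of R^m and tangent vectors at a point are row vectors 'rV[R]_m
   (coordinates w.r.t. the coordinate frame d/dx_1, ..., d/dx_m). *)

Definition ev {R : realType} {m : nat} (k : 'I_m) : 'rV[R]_m := delta_mx 0 k.

Definition pd {R : realType} {m : nat} (F : 'rV[R]_m -> R) (k : 'I_m)
  : 'rV[R]_m -> R := fun P => 'D_(ev k) F P.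

Fixpoint ipd {R : realType} {m : nat} (s : seq 'I_m) (F : 'rV[R]_m -> R)
  : 'rV[R]_m -> R :=
  match s with [::] => F | k :: s' => pd (ipd s' F) k end.

Definition smooth {R : realType} {m : nat} (F : 'rV[R]_m -> R) : Prop :=
  forall s : seq 'I_m,
    continuous (ipd s F) /\ (forall (k : 'I_m) (P : 'rV[R]_m), derivable (ipd s F) P (ev k)).

(* G P is the matrix (g(d_i, d_j))_{ij} at the point P. *)

Definition dmet {R : realType} {m : nat} (G : 'rV[R]_m -> 'M[R]_m) (k i j : 'I_m)
  (P : 'rV[R]_m) : R := 'D_(ev k) (fun Q => G Q i j) P.

(* Christoffel symbols: nabla_{d_i} d_j = sum_h Gamma^h_{ij} d_h *)
Definition christoffel {R : realType} {m : nat} (G : 'rV[R]_m -> 'M[R]_m)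
  (h i j : 'I_m) (P : 'rV[R]_m) : R :=
  2^-1 * \sum_(l < m) invmx (G P) h l * (dmet G i j l P + dmet G j i l P - dmet G l i j P).

(* R(d_i, d_j) d_k = sum_h curv_up h i j k d_h,
   with R(x,y) = nabla_x nabla_y - nabla_y nabla_x - nabla_[x,y] *)
Definition curv_up {R : realType} {m : nat} (G : 'rV[R]_m -> 'M[R]_m)
  (h i j k : 'I_m) (P : 'rV[R]_m) : R :=
  'D_(ev i) (christoffel G h j k) P - 'D_(ev j) (christoffel G h i k) P
  + \sum_(l < m) (christoffel G l j k P * christoffel G h i l P
                  - christoffel G l i k P * christoffel G h j l P).

Definition curv4 {R : realType} {m : nat} (G : 'rV[R]_m -> 'M[R]_m)
  (i j k l : 'I_m) (P : 'rV[R]_m) : R :=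
  \sum_(h < m) curv_up G h i j k P * G P h l.

Definition ricci {R : realType} {m : nat} (G : 'rV[R]_m -> 'M[R]_m)
  (i j : 'I_m) (P : 'rV[R]_m) : R :=
  \sum_(a < m) \sum_(b < m) invmx (G P) a b * curv4 G i a b j P.

Definition scal {R : realType} {m : nat} (G : 'rV[R]_m -> 'M[R]_m) (P : 'rV[R]_m) : R :=
  \sum_(a < m) \sum_(b < m) invmx (G P) a b * ricci G a b P.

Definition weyl {R : realType} {m : nat} (G : 'rV[R]_m -> 'M[R]_m)
  (i j k l : 'I_m) (P : 'rV[R]_m) : R :=
  let g := G P in
  let rho := fun a b => ricci G a b P in
  curv4 G i j k l P
  - (m%:R - 2)^-1 * (rho i l * g j k + g i l * rho j k)
  + (m%:R - 2)^-1 * (rho i k * g j l + g i k * rho j l)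
  + scal G P / ((m%:R - 1) * (m%:R - 2)) * (g i l * g j k - g i k * g j l).

Definition weylv {R : realType} {m : nat} (G : 'rV[R]_m -> 'M[R]_m) (P : 'rV[R]_m)
  (x y z w : 'rV[R]_m) : R :=
  \sum_(i < m) \sum_(j < m) \sum_(k < m) \sum_(l < m)
     x 0 i * y 0 j * z 0 k * w 0 l * weyl G i j k l P.

Definition gform {R : realType} {m : nat} (G : 'rV[R]_m -> 'M[R]_m) (P : 'rV[R]_m)
  (x y : 'rV[R]_m) : R :=
  \sum_(i < m) \sum_(j < m) x 0 i * y 0 j * G P i j.

(* Matrix (acting on row vectors: y |-> y *m A) of the Jacobi operator J_W(x),
   g(J_W(x) y, z) = W(y, x, x, z) *)
Definition jacobiW {R : realType} {m : nat} (G : 'rV[R]_m -> 'M[R]_m) (P : 'rV[R]_m)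
  (x : 'rV[R]_m) : 'M[R]_m :=
  \matrix_(j, l) \sum_(k < m) weylv G P (ev j) x x (ev k) * invmx (G P) k l.

(* Matrix (acting on row vectors) of W(pi) for pi oriented by the orthonormal
   basis {e1, e2}: g(W(pi) x, y) = W(e1, e2, x, y) *)
Definition weylPlane {R : realType} {m : nat} (G : 'rV[R]_m -> 'M[R]_m) (P : 'rV[R]_m)
  (e1 e2 : 'rV[R]_m) : 'M[R]_m :=
  \matrix_(j, l) \sum_(k < m) weylv G P e1 e2 (ev j) (ev k) * invmx (G P) k l.

(* {e1,e2} orthonormal with g(e1,e1) = g(e2,e2) = eps: eps = 1 gives exactly the
   oriented spacelike 2-planes, eps = -1 the oriented timelike ones *)
Definition orthonormal_pair {R : realType} {m : nat} (G : 'rV[R]_m -> 'M[R]_m)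
  (P : 'rV[R]_m) (eps : R) (e1 e2 : 'rV[R]_m) : Prop :=
  gform G P e1 e1 = eps /\ gform G P e2 e2 = eps /\ gform G P e1 e2 = 0.

(* "Same Jordan normal form" = similar matrices *)
Definition same_jordan_form {R : realType} {m : nat} (A B : 'M[R]_m) : Prop :=
  similar_in unitmx A B.

Definition conf_spacelike_JO {R : realType} {m : nat} (G : 'rV[R]_m -> 'M[R]_m) : Prop :=
  forall (P x y : 'rV[R]_m), gform G P x x = 1 -> gform G P y y = 1 ->
    same_jordan_form (jacobiW G P x) (jacobiW G P y).

Definition conf_timelike_JO {R : realType} {m : nat} (G : 'rV[R]_m -> 'M[R]_m) : Prop :=
  forall (P x y : 'rV[R]_m), gform G P x x = -1 -> gform G P y y = -1 ->
    same_jordan_form (jacobiW G P x) (jacobiW G P y).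

Definition conf_spacelike_JIP {R : realType} {m : nat} (G : 'rV[R]_m -> 'M[R]_m) : Prop :=
  forall (P e1 e2 f1 f2 : 'rV[R]_m),
    orthonormal_pair G P 1 e1 e2 -> orthonormal_pair G P 1 f1 f2 ->
    same_jordan_form (weylPlane G P e1 e2) (weylPlane G P f1 f2).

Definition conf_timelike_JIP {R : realType} {m : nat} (G : 'rV[R]_m -> 'M[R]_m) : Prop :=
  forall (P e1 e2 f1 f2 : 'rV[R]_m),
    orthonormal_pair G P (-1) e1 e2 -> orthonormal_pair G P (-1) f1 f2 ->
    same_jordan_form (weylPlane G P e1 e2) (weylPlane G P f1 f2).

(* coordinates (x_1..x_p, y_1..y_p): index lshift = x_i, rshift = y_i;
   the x-part of a point P is lsubmx P *)
Definition metric_gf {R : realType} {p : nat} (f : 'rV[R]_p -> R)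
  (P : 'rV[R]_(p + p)) : 'M[R]_(p + p) :=
  \matrix_(i, j)
    match fintype.split i, fintype.split j with
    | inl a, inl b => pd f a (lsubmx P) * pd f b (lsubmx P)
    | inl a, inr b => (a == b)%:R
    | inr a, inl b => (a == b)%:R
    | inr _, inr _ => 0
    end.

Definition hessian {R : realType} {p : nat} (f : 'rV[R]_p -> R) (P : 'rV[R]_(p + p))
  : 'M[R]_p :=
  \matrix_(i, j) pd (pd f j) i (lsubmx P).

Definition qform {R : realType} {p : nat} (H : 'M[R]_p) (v : 'rV[R]_p) : R :=
  (v *m H *m v^T) 0 0.

Definition H_definite {R : realType} {p : nat} (H : 'M[R]_p) : Prop :=
  (forall v : 'rV[R]_p, v != 0 -> 0 < qform H v) \/
  (forall v : 'rV[R]_p, v != 0 -> qform H v < 0).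

Definition H_indefinite {R : realType} {p : nat} (H : 'M[R]_p) : Prop :=
  exists v w : 'rV[R]_p, 0 < qform H v /\ qform H w < 0.

Definition H_nondegenerate {R : realType} {p : nat} (H : 'M[R]_p) : Prop :=
  H \in unitmx.

(* Main.v *)
Require Import Defs.
From HB Require Import structures.
From mathcomp Require Import all_boot all_order all_algebra.
From mathcomp Require Import mxred.
From mathcomp Require Import all_classical all_reals all_analysis.
From mathcomp Require Import ring lra.
Set Implicit Arguments.
Unset Strict Implicit.
Unset Printing Implicit Defensive.

Import Order.TTheory GRing.Theory Num.Theory.
Import numFieldNormedType.Exports.
Local Open Scope ring_scope.

(* Write d for the gradient and H for the Hessian of f.  The only nonzero
   Christoffel symbols of g_f are Gamma^{y_h}_{x_i x_j} = H_ij d_h, so, third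
   derivatives being symmetric, the only nonzero curvature components are
   R(x_i, x_j, x_k, x_l) = H_jk H_il - H_ik H_jl.  As the inverse metric vanishes
   on pairs of x-indices, g_f is Ricci flat and W = R.  Raising an index turns the
   x-block K of a form into the nilpotent matrix [[0, K], [0, 0]], whose
   similarity class is determined by the rank of K.  If a and b are the x-parts of
   the vectors involved, K is H(a,a) H - (aH)^T (aH) for the Jacobi operator and
   (bH)^T (aH) - (aH)^T (bH) for a 2-plane; the x-part of a non-null vector is
   nonzero, and every nonzero a is the x-part of a vector of any prescribed
   norm. *)

(** * Matrices *)

Section NilpotentBlock.
Variables (F : fieldType) (p : nat).
Implicit Types K L : 'M[F]_p.

Definition nilblock K : 'M[F]_(p + p) := block_mx 0 K 0 0.

Lemma mulmx_nilblock K L : nilblock K *m nilblock L = 0.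
Proof.
by rewrite /nilblock mulmx_block !mulmx0 !mul0mx !addr0 /block_mx row_mx0 col_mx0.
Qed.

Lemma mxrank_nilblock K : \rank (nilblock K) = \rank K.
Proof. by rewrite /nilblock /block_mx row_mx0 rank_col_mx0 rank_row_0mx. Qed.

(** By Gaussian elimination, [K] and [L] of equal rank factor through the same partial identity, so
    there are invertible [U] and [W] with [U K = L W]. The block diagonal matrix of [U] and [W] then
    intertwines the two nilpotent blocks. *)
Lemma similar_nilblock K L :
  \rank K = \rank L -> similar_in unitmx (nilblock K) (nilblock L).
Proof.
move=> eqr.
set U := col_ebase L *m invmx (col_ebase K).
set W := invmx (row_ebase L) *m row_ebase K.
have uU : U \in unitmx by rewrite unitmx_mul unitmx_inv !col_ebase_unit.
have uW : W \in unitmx by rewrite unitmx_mul unitmx_inv !row_ebase_unit.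
have uUW : block_mx U 0 0 W \in unitmx.
  by rewrite unitmxE det_ublock unitrM -!unitmxE uU uW.
exists (block_mx U 0 0 W) => //.
apply/(similarP uUW).
rewrite /nilblock !mulmx_block !mulmx0 !mul0mx !addr0 !add0r.
congr block_mx.
rewrite -{1}(mulmx_ebase K) -{1}(mulmx_ebase L) eqr /U /W !mulmxA.
by rewrite mulmxKV ?col_ebase_unit// mulmxK ?row_ebase_unit.
Qed.

End NilpotentBlock.

(** * Ranks of rank-one perturbations and of wedges *)

Section RankOfForms.
Variables (F : fieldType) (p : nat).
Implicit Types (H : 'M[F]_p) (u v : 'rV[F]_p).

Lemma mxrank_tr_mul_leq1 u v : (\rank (u^T *m v)%R <= 1)%N.
Proof. exact: leq_trans (mxrankM_maxr _ _) (rank_leq_row _). Qed.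

(** Adding back the rank-one term [u^T u] gives [c H], of full rank [p]; rank is subadditive. *)
Lemma mxrank_rank1_update H u (c : F) : c != 0 -> H \in unitmx ->
  (p.-1 <= \rank (c *: H - u^T *m u)%R)%N.
Proof.
move=> c0 uH.
have := mxrank_add (c *: H - u^T *m u) (u^T *m u).
rewrite subrK mxrank_scale_nz// mxrank_unit// => /leq_trans.
move=> /(_ _ (leq_add (leqnn _) (mxrank_tr_mul_leq1 u u))).
by rewrite -subn1 leq_subLR addnC.
Qed.

Lemma mxrank_singular_leq (K : 'M[F]_p) u : u != 0 -> u *m K = 0 ->
  (\rank K <= p.-1)%N.
Proof.
move=> u0 uK.
have : ~~ row_free K.
  by apply/negP => fK; move: u0; rewrite -(mulmx_free_eq0 _ fK) uK eqxx.
rewrite /row_free; have := rank_leq_row K.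
by rewrite leq_eqVlt => /orP[-> //|lt _]; rewrite -ltnS (ltn_predK lt).
Qed.

Lemma row_free_pair u v :
  (forall s t : F, s *: u + t *: v = 0 -> s = 0 /\ t = 0) ->
  row_free (col_mx u v).
Proof.
move=> indep; apply: inj_row_free => w.
rewrite -[w]hsubmxK mul_row_col.
rewrite [lsubmx w]mx11_scalar [rsubmx w]mx11_scalar !mul_scalar_mx.
by move=> /indep[-> ->]; rewrite -scalemx1 scale0r row_mx0.
Qed.

(** The wedge factors as the [p x 2] matrix with columns [u^T], [v^T] times the [2 x p] matrix with
    rows [-v], [u]. Independence gives both factors rank 2. *)
Lemma mxrank_wedge u v :
  (forall s t : F, s *: u + t *: v = 0 -> s = 0 /\ t = 0) ->
  \rank (v^T *m u - u^T *m v)%R = 2%N.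
Proof.
move=> indep.
have -> : v^T *m u - u^T *m v = row_mx u^T v^T *m col_mx (- v) u.
  by rewrite mul_row_col mulmxN addrC.
rewrite mxrankMfree; last first.
  apply: row_free_pair => s t; rewrite scalerN -scaleNr addrC.
  by move=> /indep[-> /eqP]; rewrite oppr_eq0 => /eqP ->.
by rewrite -tr_col_mx mxrank_tr; apply/eqP/row_free_pair.
Qed.

End RankOfForms.

(** * Ranks of the Jacobi and plane forms, by signature of H *)

Section RealForms.
Variables (R : realType) (p : nat).
Implicit Types (H : 'M[R]_p) (a b : 'rV[R]_p).

Definition jacobi_form H a : 'M[R]_p := qform H a *: H - (a *m H)^T *m (a *m H).

Definition plane_form H a b : 'M[R]_p :=
  (b *m H)^T *m (a *m H) - (a *m H)^T *m (b *m H).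

Lemma definite_unitmx H : H_definite H -> H \in unitmx.
Proof.
move=> defH; rewrite -row_free_unit; apply: inj_row_free => v vH.
apply: contraPeq (vH) => v0 _.
by case: defH => /(_ v v0); rewrite /qform vH mul0mx mxE ltxx.
Qed.

Lemma definite_qform_neq0 H a : H_definite H -> a != 0 -> qform H a != 0.
Proof. by case=> h /h; [move/lt0r_neq0|move/ltr0_neq0]. Qed.

Lemma trmx_mul_sym H a : H^T = H -> (a *m H)^T = H *m a^T.
Proof. by move=> symH; rewrite trmx_mul symH. Qed.

Lemma mulmx_jacobi_form H a : H^T = H -> a *m jacobi_form H a = 0.
Proof.
move=> symH; rewrite /jacobi_form mulmxBr trmx_mul_sym// -scalemxAr !mulmxA.
by rewrite [a *m H *m a^T]mx11_scalar -/(qform _ _) -mulmxA mul_scalar_mx subrr.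
Qed.

(** The vector [a] lies in the kernel, which bounds the rank above; as H(a,a) is nonzero, the
    rank-one update bounds it below. *)
Lemma mxrank_jacobi_form_definite H a : H^T = H -> H_definite H -> a != 0 ->
  \rank (jacobi_form H a) = p.-1.
Proof.
move=> symH defH a0; apply/eqP; rewrite eqn_leq.
rewrite (mxrank_singular_leq (u := a)) ?mulmx_jacobi_form//=.
by apply: mxrank_rank1_update; [exact: definite_qform_neq0|exact: definite_unitmx].
Qed.

Lemma qformZ H (k : R) a : qform H (k *: a) = k ^+ 2 * qform H a.
Proof. by rewrite /qform linearZ/= -!scalemxAl -scalemxAr scalerA mxE. Qed.

(** The right-hand side is the Gram determinant of [a] and [b] for H; a nonzero value shows that the
    Jacobi form of [a] is nonzero. *)
Lemma qform_jacobi_form H a b : H^T = H ->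
  qform (jacobi_form H a) b = qform H a * qform H b - (a *m H *m b^T) 0 0 ^+ 2.
Proof.
move=> symH; rewrite /qform /jacobi_form mulmxBr mulmxBl -scalemxAr -scalemxAl.
rewrite [LHS]mxE [X in X + _]mxE [X in _ + X]mxE -/(qform _ _); congr (_ - _).
have -> : b *m ((a *m H)^T *m (a *m H)) *m b^T =
          (a *m H *m b^T)^T *m (a *m H *m b^T).
  by rewrite [in RHS]trmx_mul trmxK !mulmxA.
by rewrite [a *m H *m b^T]mx11_scalar tr_scalar_mx mul_scalar_mx !mxE eqxx mulr1n expr2.
Qed.

(* For indefinite H, the rank of the Jacobi form is not constant on nonzero
   vectors: a kernel vector gives rank 0 against rank >= 1 when H is singular,
   a null vector gives rank at most 1 against at least p - 1 when it is not. *)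
Lemma indefinite_jacobi_rank H : (3 <= p)%N -> H^T = H -> H_indefinite H ->
  exists a b, [/\ a != 0, b != 0 &
    \rank (jacobi_form H a) != \rank (jacobi_form H b)].
Proof.
move=> hp symH [v [w [v0 w0]]].
have nzv : v != 0 by apply: contraTneq v0 => ->; rewrite /qform !mul0mx mxE ltxx.
have nzw : w != 0 by apply: contraTneq w0 => ->; rewrite /qform !mul0mx mxE ltxx.
have [uH|] := boolP (H \in unitmx); last first.
  rewrite -row_free_unit -kermx_eq0 => /rowV0Pn[a /sub_kermxP aH nza].
  exists a, v; split=> //.
  have -> : jacobi_form H a = 0.
    by rewrite /jacobi_form /qform aH mul0mx mulmx0 mxE scale0r subrr.
  rewrite mxrank0 eq_sym mxrank_eq0; apply/eqP => Kv.
  (* If the form of [v] vanished, the Gram determinant of [v] and [w] would be 0; but it is at most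
     H(v,v) H(w,w) < 0. *)
  have := qform_jacobi_form v w symH.
  rewrite Kv /qform mulmx0 mul0mx -/(qform H v) -/(qform H w) mxE.
  have := sqr_ge0 ((v *m H *m w^T) 0 0); nra.
set c := (v *m H *m w^T) 0 0.
have wHv : (w *m H *m v^T) 0 0 = c.
  rewrite /c -[v *m H *m w^T]trmxK [RHS]mxE; congr (fun_of_matrix _ _ _).
  by rewrite !trmx_mul trmxK symH mulmxA.
have qt t : qform H (v + t *: w) = qform H v + t * c *+ 2 + t ^+ 2 * qform H w.
  rewrite /qform linearD/= linearZ/= !mulmxDl !mulmxDr -!scalemxAl -!scalemxAr.
  have addE (A B : 'M[R]_1) : (A + B) 0 0 = A 0 0 + B 0 0 by rewrite mxE.
  have scaleE (k : R) (A : 'M[R]_1) : (k *: A) 0 0 = k * A 0 0 by rewrite mxE.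
  by rewrite !(addE, scaleE) wHv -/c; ring.
(* A root of the quadratic H(v + t w, v + t w) in [t]; it is real because H(v,v) and H(w,w) have
   opposite signs. *)
pose t := (- c - Num.sqrt (c ^+ 2 - qform H v * qform H w)) / qform H w.
have qt0 : qform H (v + t *: w) = 0.
  have D0 : 0 <= c ^+ 2 - qform H v * qform H w by nra.
  rewrite qt /t; have /eqP := sqr_sqrtr D0.
  set s := Num.sqrt _ => /eqP s2.
  have w0' : qform H w != 0 by rewrite lt_eqF.
  apply: (mulIf w0'); rewrite mul0r.
  transitivity (qform H v * qform H w + s ^+ 2 - c ^+ 2); first by field.
  by rewrite s2; ring.
exists (v + t *: w), v; split=> //.
  (* Otherwise v = -t w, and H(v,v) = t^2 H(w,w) would not be positive. *)
  apply: contraTneq v0 => /eqP; rewrite addr_eq0 => /eqP ->.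
  by rewrite -scaleNr qformZ -leNgt mulr_ge0_le0 ?sqr_ge0// ltW.
(* At the null vector only the rank-one term survives, and [3 <= p] gives 1 < p - 1. *)
rewrite ltn_eqF//; apply: (@leq_ltn_trans 1).
  by rewrite /jacobi_form qt0 scale0r sub0r mxrank_opp mxrank_tr_mul_leq1.
apply: leq_trans (mxrank_rank1_update _ _ _) => //; last by rewrite gt_eqF.
by rewrite -subn1 ltn_subRL.
Qed.

(** This is the wedge of [a H] and [b H], which stay independent because H is invertible. *)
Lemma mxrank_plane_form H a b : H \in unitmx ->
  (forall s t : R, s *: a + t *: b = 0 -> s = 0 /\ t = 0) ->
  \rank (plane_form H a b) = 2%N.
Proof.
move=> uH indep; apply: mxrank_wedge => s t.
rewrite !scalemxAl -mulmxDl => /eqP.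
by rewrite mulmx_free_eq0 ?row_free_unit// => /eqP /indep.
Qed.

End RealForms.

(** * Symmetry of second derivatives *)

Section Schwarz.
Variable R : realType.

Section Affine.
Variables (U V W : normedModType R) (F : V -> W) (L : U -> V) (x v : U) (w : V).
Hypothesis affL : forall h : R, L (h *: v + x) = h *: w + L x.

(** The difference quotients themselves agree, so derivatives transfer without a chain rule. This
    serves for lines, translations and the projection to the x-coordinates. *)
Let quotientE :
  (fun h : R => h^-1 *: (((F \o L) \o shift x) (h *: v) - (F \o L) x)) =
  (fun h : R => h^-1 *: ((F \o shift (L x)) (h *: w) - F (L x))).
Proof. by apply/funext => h /=; rewrite affL. Qed.

Lemma derive_comp_affine : 'D_v (F \o L) x = 'D_w F (L x).
Proof. by rewrite /derive quotientE. Qed.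

Lemma derivable_comp_affine : derivable F (L x) w -> derivable (F \o L) x v.
Proof. by rewrite /derivable quotientE. Qed.

End Affine.

Variable V : normedModType R.
Implicit Types (F : V -> R) (u v P Q : V).

Lemma MVT_direction F v Q (h : R) : 0 < h -> (forall Q, derivable F Q v) ->
  exists2 c, 0 < c < h & F (Q + h *: v) - F Q = h * 'D_v F (Q + c *: v).
Proof.
move=> h0 dF.
pose L (t : R) : V := Q + t *: v.
have affL (t k : R) : L (k *: 1 + t) = k *: v + L t.
  by rewrite /L scalerDl addrCA -scalerA scale1r.
have dphi (t : R) : derivable (F \o L) t 1 by apply: (derivable_comp_affine (affL t)).
have [t _||c] := @MVT R (F \o L) (fun t => 'D_v F (L t)) 0 h h0.
- by rewrite -(derive_comp_affine _ (affL t)); apply/derivableP.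
- by apply: derivable_within_continuous => t _.
rewrite in_itv /= => c0h; rewrite /L scale0r addr0 subr0 => ->.
by exists c => //; rewrite mulrC.
Qed.

(** Two mean value steps: along [u] for the increment F(Q + h v) - F(Q), then along [v] for the
    derivative of [F] in direction [u]. *)
Lemma second_difference F u v P (h : R) : 0 < h ->
  (forall Q, derivable F Q u) -> (forall Q, derivable ('D_u F) Q v) ->
  exists s t : R, [/\ 0 < s < h, 0 < t < h &
    F (P + h *: u + h *: v) - F (P + h *: u) - (F (P + h *: v) - F P) =
    h * (h * 'D_v ('D_u F) (P + s *: u + t *: v))].
Proof.
move=> h0 dF ddF.
pose L (Q : V) : V := Q + h *: v.
have affL (Q : V) (k : R) : L (k *: u + Q) = k *: u + L Q by rewrite /L addrA.
have dL Q : derivable (F \o L) Q u by apply: (derivable_comp_affine (affL Q)).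
have [Q|s s0h] := @MVT_direction (F \o L - F) u P h h0.
  exact: derivableB.
rewrite deriveB// (derive_comp_affine _ (affL _)).
have [t t0h E] := MVT_direction (P + s *: u) h0 ddF.
rewrite /L E => E'; exists s, t; split=> //.
Qed.

(** The second difference is symmetric in [u] and [v], so the two mixed derivatives take a common
    value at points arbitrarily close to [P], and continuity at [P] concludes. *)
Lemma schwarz F u v P :
  (forall Q, derivable F Q u) -> (forall Q, derivable F Q v) ->
  (forall Q, derivable ('D_u F) Q v) -> (forall Q, derivable ('D_v F) Q u) ->
  {for P, continuous ('D_v ('D_u F))} -> {for P, continuous ('D_u ('D_v F))} ->
  'D_v ('D_u F) P = 'D_u ('D_v F) P.
Proof.
move=> dFu dFv ddFu ddFv cuv cvu; apply/eqP; rewrite -subr_eq0 -normr_le0.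
apply/ler_addgt0Pr => e e0; rewrite add0r.
have tri (x y z : R) : `|x - z| < e / 2 -> `|y - z| < e / 2 -> `|x - y| <= e.
  move=> xz yz; rewrite -(subrKA z) (le_trans (ler_normD _ _))//.
  by rewrite [e]splitr ltW// ltrD// distrC.
have e2 : 0 < e / 2 by rewrite divr_gt0.
move/cvgrPdist_lt : cuv => /(_ _ e2)/nbhs_ballP[d1 /= d10 B1].
move/cvgrPdist_lt : cvu => /(_ _ e2)/nbhs_ballP[d2 /= d20 B2].
pose d := Num.min d1 d2.
have d0 : 0 < d by rewrite lt_min d10.
(* With h = d / N, all points P + s u + t v with 0 < s, t < h are within [d] of [P]; the added 1
   keeps N positive when u = v = 0. *)
pose N := `|u| + `|v| + 1.
have N0 : 0 < N by rewrite ltr_wpDl// addr_ge0.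
pose h := d / N.
have h0 : 0 < h by rewrite divr_gt0.
have near (s t : R) : 0 < s < h -> 0 < t < h -> `|s *: u + t *: v| < d.
  move=> /andP[s0 sh] /andP[t0 th].
  rewrite (le_lt_trans (ler_normD _ _))// !normrZ !gtr0_norm//.
  apply: (@le_lt_trans _ _ (h * (`|u| + `|v|))).
    by rewrite mulrDr lerD// ler_wpM2r// ltW.
  by rewrite /h mulrAC ltr_pdivrMr// ltr_pM2l// /N ltrDl.
have [s [t [s0 t0 E1]]] := second_difference P h0 dFu ddFu.
have [t' [s' [t'0 s'0 E2]]] := second_difference P h0 dFv ddFv.
have E : 'D_v ('D_u F) (P + s *: u + t *: v) = 'D_u ('D_v F) (P + t' *: v + s' *: u).
  apply: (mulfI (lt0r_neq0 h0)); apply: (mulfI (lt0r_neq0 h0)).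
  rewrite -E1 -E2 -!addrA [h *: v + _]addrC; congr (_ + _).
  by rewrite !opprB addrCA [RHS]addrCA [- _ - _]addrC.
have /B1 C1 : ball P d1 (P + s *: u + t *: v).
  rewrite -ball_normE /ball_/= -addrA opprD addrA subrr add0r normrN.
  by apply: lt_le_trans (near _ _ s0 t0) _; rewrite ge_min lexx.
have /B2 C2 : ball P d2 (P + t' *: v + s' *: u).
  rewrite -ball_normE /ball_/= -addrA opprD addrA subrr add0r normrN addrC.
  by apply: lt_le_trans (near _ _ s'0 t'0) _; rewrite ge_min lexx orbT.
rewrite /= in C1 C2; rewrite E in C1; exact: tri C1 C2.
Qed.

End Schwarz.

Section SmoothFunctions.
Variables (R : realType) (m : nat).
Implicit Types (F : 'rV[R]_m -> R) (i j k : 'I_m).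

(** The last index of the list is differentiated first, so smoothness passes to partial
    derivatives. *)
Lemma ipd_rcons F s k : ipd (rcons s k) F = ipd s (pd F k).
Proof. by elim: s => //= i s ->. Qed.

Lemma smooth_pd F k : smooth F -> smooth (pd F k).
Proof. by move=> sF s; rewrite -ipd_rcons; exact: sF. Qed.

Lemma smooth_derivable F k P : smooth F -> derivable F P (ev k).
Proof. by move=> /(_ [::])[_]; exact. Qed.

Lemma pdC F i j P : smooth F -> pd (pd F i) j P = pd (pd F j) i P.
Proof.
move=> sF; apply: schwarz.
- by move=> Q; exact: smooth_derivable.
- by move=> Q; exact: smooth_derivable.
- by move=> Q; apply: (smooth_derivable (F := pd F i)); exact: smooth_pd.
- by move=> Q; apply: (smooth_derivable (F := pd F j)); exact: smooth_pd.
- by have [+ _] := sF [:: j; i]; apply.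
- by have [+ _] := sF [:: i; j]; apply.
Qed.

End SmoothFunctions.

(** * Coordinate vectors and multilinear sums *)

Section MatrixEntries.
Variables (R : realType) (p : nat).

Lemma lsubmx_ev_lshift (k : 'I_p) : lsubmx (ev (lshift p k) : 'rV[R]_(p + p)) = ev k.
Proof. by apply/rowP => j; rewrite !mxE eq_lshift. Qed.

Lemma lsubmx_ev_rshift (k : 'I_p) : lsubmx (ev (rshift p k) : 'rV[R]_(p + p)) = 0.
Proof. by apply/rowP => j; rewrite !mxE eq_lrshift andbF. Qed.

Lemma mxE_ev n (A : 'M[R]_(p, n)) i j : (ev i *m A) 0 j = A i j.
Proof. by rewrite /ev -rowE mxE. Qed.

Lemma mxE_trev n (A : 'M[R]_(n, p)) i j : (A *m (ev j)^T) i 0 = A i j.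
Proof. by rewrite /ev trmx_delta -colE mxE. Qed.

Lemma bilinear_sumE n (A : 'M[R]_n) (x y : 'rV[R]_n) :
  (x *m A *m y^T) 0 0 = \sum_i \sum_j x 0 i * y 0 j * A i j.
Proof.
rewrite mxE exchange_big /=; apply: eq_bigr => j _; rewrite !mxE mulr_suml.
by apply: eq_bigr => i _; rewrite mulrAC.
Qed.

(** The index pattern of the curvature term H_jk H_il; the next lemma treats that of H_ik H_jl. *)
Lemma sum_prod_outer (n : nat) (A B : 'I_n -> 'I_n -> R) :
  \sum_i \sum_j \sum_k \sum_l A j k * B i l =
  (\sum_j \sum_k A j k) * (\sum_i \sum_l B i l).
Proof.
rewrite mulr_sumr; apply: eq_bigr => i _; rewrite mulr_suml.
apply: eq_bigr => j _; rewrite mulr_suml.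
by apply: eq_bigr => k _; rewrite mulr_sumr.
Qed.

Lemma sum_prod_alternate (n : nat) (A B : 'I_n -> 'I_n -> R) :
  \sum_i \sum_j \sum_k \sum_l A i k * B j l =
  (\sum_i \sum_k A i k) * (\sum_j \sum_l B j l).
Proof.
rewrite mulr_suml; apply: eq_bigr => i _; rewrite mulr_sumr.
apply: eq_bigr => j _; rewrite mulr_suml.
by apply: eq_bigr => k _; rewrite mulr_sumr.
Qed.

Lemma sum_lshift (F : 'I_(p + p) -> R) : (forall i, F (rshift p i) = 0) ->
  \sum_i F i = \sum_(i < p) F (lshift p i).
Proof. by move=> F0; rewrite big_split_ord /= [X in _ + X]big1 ?addr0. Qed.

Lemma sum_rshift (F : 'I_(p + p) -> R) : (forall i, F (lshift p i) = 0) ->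
  \sum_i F i = \sum_(i < p) F (rshift p i).
Proof. by move=> F0; rewrite big_split_ord /= [X in X + _]big1 ?add0r. Qed.

Lemma sum_deltal (i : 'I_p) (F : 'I_p -> R) : \sum_j (i == j)%:R * F j = F i.
Proof.
rewrite (bigD1 i) //= eqxx mul1r big1 ?addr0// => j.
by rewrite eq_sym => /negPf ->; rewrite mul0r.
Qed.

Lemma gformE m (G : 'rV[R]_m -> 'M[R]_m) P x y :
  gform G P x y = (x *m G P *m y^T) 0 0.
Proof. by rewrite bilinear_sumE. Qed.

End MatrixEntries.

(** * Derivatives of functions of the x-coordinates alone *)

Section PullbackDerivative.
Variables (R : realType) (p : nat).
Implicit Types (F : 'rV[R]_p -> R) (P : 'rV[R]_(p + p)).

Lemma derive_lsubmx F P v :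
  'D_v (fun Q : 'rV[R]_(p + p) => F (lsubmx Q)) P = 'D_(lsubmx v) F (lsubmx P).
Proof.
by apply: (derive_comp_affine F (L := lsubmx)) => h; rewrite linearD linearZ.
Qed.

Lemma derive_lsubmx_lshift F P k :
  'D_(ev (lshift p k)) (fun Q : 'rV[R]_(p + p) => F (lsubmx Q)) P = pd F k (lsubmx P).
Proof. by rewrite derive_lsubmx lsubmx_ev_lshift. Qed.

Lemma derive_lsubmx_rshift F P k :
  'D_(ev (rshift p k)) (fun Q : 'rV[R]_(p + p) => F (lsubmx Q)) P = 0.
Proof. by rewrite derive_lsubmx lsubmx_ev_rshift derive0. Qed.

Lemma pdM F1 F2 k Q : smooth F1 -> smooth F2 ->
  pd (fun Q => F1 Q * F2 Q) k Q = F1 Q * pd F2 k Q + F2 Q * pd F1 k Q.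
Proof.
move=> s1 s2; rewrite /pd (deriveM (f := F1) (g := F2))//; exact: smooth_derivable.
Qed.

End PullbackDerivative.

(** * Curvature of [g_f] *)

Section Curvature.
Variables (R : realType) (p : nat) (f : 'rV[R]_p -> R).
Hypothesis sf : smooth f.
Local Notation G := (metric_gf f).
Local Notation l_ := (lshift p).
Local Notation r_ := (rshift p).
Implicit Types (P : 'rV[R]_(p + p)).

Let H P : 'M[R]_p := hessian f P.
Let d P : 'rV[R]_p := \row_j pd f j (lsubmx P).

Lemma hessianC P i j : H P i j = H P j i.
Proof. by rewrite !mxE; exact: pdC. Qed.

Lemma hessian_sym P : (H P)^T = H P.
Proof. by apply/matrixP => i j; rewrite mxE hessianC. Qed.

Lemma metric_gfE P : G P = block_mx ((d P)^T *m d P) 1%:M 1%:M 0.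
Proof.
apply/matrixP => i j; rewrite [LHS]mxE.
case: (split_ordP i) => a ->; case: (split_ordP j) => b ->.
- by rewrite block_mxEul !mxE big_ord1 !mxE.
- by rewrite block_mxEur !mxE.
- by rewrite block_mxEdl !mxE.
- by rewrite block_mxEdr !mxE.
Qed.

Lemma metric_gf_ll P a b :
  G P (l_ a) (l_ b) = pd f a (lsubmx P) * pd f b (lsubmx P).
Proof. by rewrite metric_gfE block_mxEul !mxE big_ord1 !mxE. Qed.

Lemma metric_gf_lr P a b : G P (l_ a) (r_ b) = (a == b)%:R.
Proof. by rewrite metric_gfE block_mxEur !mxE. Qed.

Lemma metric_gf_rl P a b : G P (r_ a) (l_ b) = (a == b)%:R.
Proof. by rewrite metric_gfE block_mxEdl !mxE. Qed.

Lemma metric_gf_rr P a b : G P (r_ a) (r_ b) = 0.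
Proof. by rewrite metric_gfE block_mxEdr !mxE. Qed.

Lemma invmx_metric_gf P :
  invmx (G P) = block_mx 0 1%:M 1%:M (- ((d P)^T *m d P)).
Proof.
have GV : G P *m block_mx 0 1%:M 1%:M (- ((d P)^T *m d P)) = 1%:M.
  rewrite metric_gfE mulmx_block !mulmx0 !mul0mx !mul1mx !mulmx1 !addr0 !add0r.
  by rewrite subrr -scalar_mx_block.
have [uG _] := mulmx1_unit GV.
by apply: (can_inj (mulKmx uG)); rewrite GV mulmxV.
Qed.

Lemma invmx_metric_gf_ll P a b : invmx (G P) (l_ a) (l_ b) = 0.
Proof. by rewrite invmx_metric_gf block_mxEul mxE. Qed.

Lemma invmx_metric_gf_rl P a b : invmx (G P) (r_ a) (l_ b) = (a == b)%:R.
Proof. by rewrite invmx_metric_gf block_mxEdl !mxE. Qed.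

Lemma dmet_rshift_dir k i j P : dmet G (r_ k) i j P = 0.
Proof.
rewrite /dmet.
case: (split_ordP i) => a ->; case: (split_ordP j) => b ->.
- under eq_fun do rewrite metric_gf_ll.
  exact: (derive_lsubmx_rshift (fun Q => pd f a Q * pd f b Q)).
- by under eq_fun do rewrite metric_gf_lr; exact: derive_cst.
- by under eq_fun do rewrite metric_gf_rl; exact: derive_cst.
- by under eq_fun do rewrite metric_gf_rr; exact: derive_cst.
Qed.

Lemma dmet_rshiftl k i j P : dmet G k (r_ i) j P = 0.
Proof.
rewrite /dmet; case: (split_ordP j) => b ->.
- by under eq_fun do rewrite metric_gf_rl; exact: derive_cst.
- by under eq_fun do rewrite metric_gf_rr; exact: derive_cst.
Qed.

Lemma dmet_rshiftr k i j P : dmet G k i (r_ j) P = 0.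
Proof.
rewrite /dmet; case: (split_ordP i) => b ->.
- by under eq_fun do rewrite metric_gf_lr; exact: derive_cst.
- by under eq_fun do rewrite metric_gf_rr; exact: derive_cst.
Qed.

Lemma dmet_lshift k i j P : dmet G (l_ k) (l_ i) (l_ j) P =
  d P 0 i * H P k j + d P 0 j * H P k i.
Proof.
rewrite /dmet; under eq_fun do rewrite metric_gf_ll.
rewrite (derive_lsubmx_lshift (fun Q => pd f i Q * pd f j Q)).
by rewrite pdM ?mxE//; exact: smooth_pd.
Qed.

Lemma christoffel_rshift_lower1 h i j : christoffel G h (r_ i) j = fun=> 0.
Proof.
apply/funext => P; rewrite /christoffel big1 ?mulr0// => l _.
by rewrite dmet_rshift_dir !dmet_rshiftl addr0 subr0 mulr0.
Qed.

Lemma christoffel_rshift_lower2 h i j : christoffel G h i (r_ j) = fun=> 0.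
Proof.
apply/funext => P; rewrite /christoffel big1 ?mulr0// => l _.
by rewrite dmet_rshift_dir dmet_rshiftl dmet_rshiftr addr0 subr0 mulr0.
Qed.

(** The x-row of the inverse metric reaches only y-indices, and every metric derivative involving a
    y-index vanishes. *)
Lemma christoffel_lshift_upper h i j : christoffel G (l_ h) i j = fun=> 0.
Proof.
apply/funext => P; rewrite /christoffel big1 ?mulr0// => l _.
case: (split_ordP l) => b ->; first by rewrite invmx_metric_gf_ll mul0r.
by rewrite dmet_rshift_dir !dmet_rshiftr addr0 subr0 mulr0.
Qed.

(** The inverse metric selects l = h; in the Leibniz expansion of the three metric derivatives
    everything cancels except 2 H_ij d_h. *)
Lemma christoffelE h i j : christoffel G (r_ h) (l_ i) (l_ j) =
  fun P => pd (pd f j) i (lsubmx P) * pd f h (lsubmx P).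
Proof.
apply/funext => P; rewrite /christoffel sum_lshift => [|b]; last first.
  by rewrite dmet_rshift_dir !dmet_rshiftr addr0 subr0 mulr0.
under eq_bigr do rewrite invmx_metric_gf_rl.
rewrite sum_deltal !dmet_lshift.
have <- : H P i j = pd (pd f j) i (lsubmx P) by rewrite mxE.
have <- : d P 0 h = pd f h (lsubmx P) by rewrite mxE.
rewrite (hessianC P j i) (hessianC P h i) (hessianC P h j).
move: (H P i j) (H P i h) (H P j h) (d P 0 i) (d P 0 j) (d P 0 h) => a b c x y z.
by field.
Qed.

(** An upper index must be of type y and a lower one of type x, and [l] occurs as both. Hence the
    quadratic terms of the curvature vanish. *)
Lemma christoffel_mul l h i j k P :
  christoffel G l j k P * christoffel G h i l P = 0.
Proof.
case: (split_ordP l) => b ->.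
- by rewrite christoffel_lshift_upper mul0r.
- by rewrite christoffel_rshift_lower2 mulr0.
Qed.

Lemma curv_upE h i j k P : curv_up G h i j k P =
  'D_(ev i) (christoffel G h j k) P - 'D_(ev j) (christoffel G h i k) P.
Proof.
by rewrite /curv_up big1 ?addr0// => l _; rewrite !christoffel_mul subrr.
Qed.

Lemma derive_christoffel_rshift k h i j P :
  'D_(ev (r_ k)) (christoffel G h i j) P = 0.
Proof.
case: (split_ordP h) => a ->; first by rewrite christoffel_lshift_upper derive_cst.
case: (split_ordP i) => b ->; last by rewrite christoffel_rshift_lower1 derive_cst.
case: (split_ordP j) => c ->; last by rewrite christoffel_rshift_lower2 derive_cst.
by rewrite christoffelE (derive_lsubmx_rshift (fun Q => pd (pd f c) b Q * pd f a Q)).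
Qed.

Lemma derive_christoffel_lshift k h i j P :
  'D_(ev (l_ k)) (christoffel G (r_ h) (l_ i) (l_ j)) P =
  H P i j * H P k h + d P 0 h * pd (pd (pd f j) i) k (lsubmx P).
Proof.
rewrite christoffelE (derive_lsubmx_lshift (fun Q => pd (pd f j) i Q * pd f h Q)).
by rewrite pdM ?mxE//; do ?apply: smooth_pd.
Qed.

Lemma curv4_lshift i j k l P : curv4 G (l_ i) (l_ j) (l_ k) (l_ l) P =
  H P j k * H P i l - H P i k * H P j l.
Proof.
rewrite /curv4 sum_rshift => [|h]; last first.
  by rewrite curv_upE !christoffel_lshift_upper !derive_cst subrr mul0r.
under eq_bigr do rewrite metric_gf_rl mulrC eq_sym.
rewrite sum_deltal curv_upE !derive_christoffel_lshift.
(* The third derivatives [t] and [t'] agree by Schwarz applied to the partial derivative of [f] in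
   direction [k]. *)
have cancel (a b x t t' : R) : t = t' -> a + x * t - (b + x * t') = a - b.
  by move=> ->; ring.
by apply: cancel; apply: pdC; exact: smooth_pd.
Qed.

Lemma curv4_rshift1 i j k l P : curv4 G (r_ i) j k l P = 0.
Proof.
rewrite /curv4 big1// => h _; rewrite curv_upE derive_christoffel_rshift.
by rewrite christoffel_rshift_lower1 derive_cst subrr mul0r.
Qed.

Lemma curv4_rshift2 i j k l P : curv4 G i (r_ j) k l P = 0.
Proof.
rewrite /curv4 big1// => h _; rewrite curv_upE derive_christoffel_rshift.
by rewrite christoffel_rshift_lower1 derive_cst subrr mul0r.
Qed.

Lemma curv4_rshift3 i j k l P : curv4 G i j (r_ k) l P = 0.
Proof.
rewrite /curv4 big1// => h _; rewrite curv_upE.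
by rewrite !christoffel_rshift_lower2 !derive_cst subrr mul0r.
Qed.

Lemma curv4_rshift4 i j k l P : curv4 G i j k (r_ l) P = 0.
Proof.
rewrite /curv4 big1// => h _; case: (split_ordP h) => a ->.
  by rewrite curv_upE !christoffel_lshift_upper !derive_cst subrr mul0r.
by rewrite metric_gf_rr mulr0.
Qed.

(* The curvature lives on the x-directions, whose block in the inverse metric
   vanishes. *)
Lemma ricci_flat i j P : ricci G i j P = 0.
Proof.
rewrite /ricci big1// => a _; rewrite big1// => b _.
case: (split_ordP a) => a' ->; last by rewrite curv4_rshift2 mulr0.
case: (split_ordP b) => b' ->; last by rewrite curv4_rshift3 mulr0.
by rewrite invmx_metric_gf_ll mul0r.
Qed.

Lemma weyl_curv4 i j k l P : weyl G i j k l P = curv4 G i j k l P.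
Proof.
have scal0 : scal G P = 0.
  by rewrite /scal big1// => a _; rewrite big1// => b _; rewrite ricci_flat mulr0.
by rewrite /weyl scal0 !ricci_flat !(mul0r, mulr0, addr0, subr0).
Qed.

Lemma weylvE P x y z w :
  let B u v := (lsubmx u *m H P *m (lsubmx v)^T) 0 0 in
  weylv G P x y z w = B y z * B x w - B x z * B y w.
Proof.
rewrite /weylv /= !bilinear_sumE -sum_prod_outer -sum_prod_alternate.
rewrite sum_lshift => [|i]; last first.
  rewrite big1// => j _; rewrite big1// => k _; rewrite big1// => l _.
  by rewrite weyl_curv4 curv4_rshift1 mulr0.
rewrite -sumrB; apply: eq_bigr => i _.
rewrite sum_lshift => [|j]; last first.
  rewrite big1// => k _; rewrite big1// => l _.
  by rewrite weyl_curv4 curv4_rshift2 mulr0.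
rewrite -sumrB; apply: eq_bigr => j _.
rewrite sum_lshift => [|k]; last first.
  by rewrite big1// => l _; rewrite weyl_curv4 curv4_rshift3 mulr0.
rewrite -sumrB; apply: eq_bigr => k _.
rewrite sum_lshift => [|l]; last by rewrite weyl_curv4 curv4_rshift4 mulr0.
rewrite -sumrB; apply: eq_bigr => l _.
rewrite weyl_curv4 curv4_lshift ![lsubmx _ _ _]mxE.
move: (H P j k) (H P i l) (H P i k) (H P j l) => a b c e.
by ring.
Qed.

(** Operators act on row vectors, so raising an index is right multiplication by the inverse metric,
    which moves the x-block to the upper right corner. *)
Lemma mul_ulblock_invmx_metric_gf P (K : 'M[R]_p) :
  block_mx K 0 0 0 *m invmx (G P) = nilblock K.
Proof.
rewrite invmx_metric_gf mulmx_block.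
by rewrite !mulmx0 !mul0mx !mulmx1 !addr0.
Qed.

(** For a the x-part of [x], W(e_j, x, x, e_k) is H(a,a) H_jk - (aH)_j (aH)_k on x-indices and 0 if
    [j] or [k] is a y-index. *)
Lemma jacobiWE P x : jacobiW G P x = nilblock (jacobi_form (H P) (lsubmx x)).
Proof.
rewrite -(mul_ulblock_invmx_metric_gf P).
apply/matrixP => j l; rewrite [LHS]mxE [RHS]mxE; apply: eq_bigr => k _.
congr (_ * _); rewrite weylvE.
have z00 : (0 : 'M[R]_1) 0 0 = 0 by rewrite mxE.
case: (split_ordP j) => a ->; last first.
  rewrite lsubmx_ev_rshift !mul0mx z00 mulr0 mul0r subrr.
  by rewrite /block_mx row_mx0 col_mxEd mxE.
case: (split_ordP k) => b ->; last first.
  rewrite lsubmx_ev_rshift trmx0 !mulmx0 z00 !mulr0 subrr.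
  by rewrite block_mxEur mxE.
rewrite !lsubmx_ev_lshift block_mxEul !mxE_trev -[ev a *m _ *m _]mulmxA !mxE_ev.
rewrite /jacobi_form trmx_mul_sym ?hessian_sym// [RHS]mxE [X in _ = X + _]mxE.
rewrite [X in _ = _ + X]mxE.
by rewrite [X in _ = _ - X]mxE big_ord1.
Qed.

Lemma weylPlaneE P x y : weylPlane G P x y =
  nilblock (plane_form (H P) (lsubmx x) (lsubmx y)).
Proof.
rewrite -(mul_ulblock_invmx_metric_gf P).
apply/matrixP => j l; rewrite [LHS]mxE [RHS]mxE; apply: eq_bigr => k _.
congr (_ * _); rewrite weylvE.
have z00 : (0 : 'M[R]_1) 0 0 = 0 by rewrite mxE.
case: (split_ordP j) => a ->; last first.
  rewrite lsubmx_ev_rshift trmx0 !mulmx0 z00 !mul0r subrr.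
  by rewrite /block_mx row_mx0 col_mxEd mxE.
case: (split_ordP k) => b ->; last first.
  rewrite lsubmx_ev_rshift trmx0 !mulmx0 z00 !mulr0 subrr.
  by rewrite block_mxEur mxE.
rewrite !lsubmx_ev_lshift block_mxEul !mxE_trev.
rewrite /plane_form [RHS]mxE [X in _ = _ + X]mxE.
by rewrite [X in _ = X - _]mxE [X in _ = _ - X]mxE !big_ord1 ![_^T _ _]mxE.
Qed.

Lemma gform_metric_gfE P x : gform G P x x =
  (d P *m (lsubmx x)^T) 0 0 ^+ 2 + (lsubmx x *m (rsubmx x)^T) 0 0 *+ 2.
Proof.
rewrite gformE metric_gfE -{1 2}[x]hsubmxK.
set a := lsubmx x; set b := rsubmx x.
rewrite mul_row_block !mulmx1 mulmx0 addr0 tr_row_mx mul_row_col mulmxDl.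
have addE (A B : 'M[R]_1) : (A + B) 0 0 = A 0 0 + B 0 0 by rewrite mxE.
have -> : b *m a^T = (a *m b^T)^T by rewrite trmx_mul trmxK.
have -> : a *m ((d P)^T *m d P) *m a^T = (d P *m a^T)^T *m (d P *m a^T).
  by rewrite [in RHS]trmx_mul trmxK !mulmxA.
rewrite !addE [(_ *m b^T)^T _ _]mxE -addrA; congr (_ + _).
by rewrite mxE big_ord1 mxE.
Qed.

Lemma gform_lsubmx0 P x : lsubmx x = 0 -> gform G P x x = 0.
Proof.
move=> x0; rewrite gform_metric_gfE x0 trmx0 mulmx0 mul0mx !mxE.
by rewrite expr0n/= mul0rn addr0.
Qed.

(** With the x-part fixed, the norm is an affine function of the y-part, nonconstant as [a] is
    nonzero, so it takes every value. *)
Lemma gform_prescribed P (a : 'rV[R]_p) (eps : R) : a != 0 ->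
  exists x, lsubmx x = a /\ gform G P x x = eps.
Proof.
move=> /rV0Pn[i ai].
(* Solves df(a)^2 + 2 k a_i = eps, the norm equation for the y-part k e_i. *)
pose k := (eps - (d P *m a^T) 0 0 ^+ 2) / (a 0 i *+ 2).
exists (row_mx a (k *: ev i)); rewrite row_mxKl; split=> //.
rewrite gform_metric_gfE row_mxKl row_mxKr linearZ/= -scalemxAr.
rewrite [X in _ + X *+ 2]mxE mxE_trev.
by rewrite /k; field.
Qed.

End Curvature.

(** * Jordan types *)

Lemma gform_combination (R : realType) m (G : 'rV[R]_m -> 'M[R]_m) P eps e1 e2
    (s t : R) :
  (G P)^T = G P -> orthonormal_pair G P eps e1 e2 ->
  gform G P (s *: e1 + t *: e2) (s *: e1 + t *: e2) = (s ^+ 2 + t ^+ 2) * eps.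
Proof.
move=> symG [g11 [g22 g12]].
have g21 : gform G P e2 e1 = 0.
  rewrite -g12 !gformE -[e1 *m _ *m _]trmxK [RHS]mxE; congr (fun_of_matrix _ _ _).
  by rewrite !trmx_mul trmxK symG mulmxA.
move: g11 g22 g12 g21; rewrite !gformE => g11 g22 g12 g21.
rewrite linearD/= !linearZ/= !mulmxDl !mulmxDr -!scalemxAl -!scalemxAr.
have addE (A B : 'M[R]_1) : (A + B) 0 0 = A 0 0 + B 0 0 by rewrite mxE.
have scaleE (k : R) (A : 'M[R]_1) : (k *: A) 0 0 = k * A 0 0 by rewrite mxE.
by rewrite !(addE, scaleE) g11 g22 g12 g21; ring.
Qed.

Section JordanType.
Variables (R : realType) (p : nat) (f : 'rV[R]_p -> R).
Hypothesis sf : smooth f.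
Local Notation G := (metric_gf f).
Implicit Types (P x : 'rV[R]_(p + p)).

Lemma lsubmx_nonnull P x : gform G P x x != 0 -> lsubmx x != 0.
Proof. by apply: contraNneq => /(gform_lsubmx0 f P) ->. Qed.

Lemma mxrank_jacobiW_definite P x : H_definite (hessian f P) ->
  gform G P x x != 0 -> \rank (jacobiW G P x) = p.-1.
Proof.
move=> defH xx; rewrite jacobiWE// mxrank_nilblock.
by rewrite mxrank_jacobi_form_definite ?hessian_sym// (lsubmx_nonnull xx).
Qed.

Lemma definite_jordan_osserman (eps : R) P x y :
  H_definite (hessian f P) -> eps != 0 ->
  gform G P x x = eps -> gform G P y y = eps ->
  same_jordan_form (jacobiW G P x) (jacobiW G P y).
Proof.
move=> defH eps0 xx yy; rewrite /same_jordan_form !jacobiWE//.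
have rk z : gform G P z z = eps ->
    \rank (jacobi_form (hessian f P) (lsubmx z)) = p.-1.
  move=> zz; rewrite -mxrank_nilblock -jacobiWE//.
  by rewrite mxrank_jacobiW_definite ?zz.
by apply: similar_nilblock; rewrite !rk.
Qed.

(** Two x-parts with Jacobi forms of different rank lift to vectors of the same norm [eps], and
    similar matrices have equal rank. *)
Lemma indefinite_not_jordan_osserman (eps : R) P : (3 <= p)%N ->
  H_indefinite (hessian f P) ->
  exists x y, [/\ gform G P x x = eps, gform G P y y = eps &
    ~ same_jordan_form (jacobiW G P x) (jacobiW G P y)].
Proof.
move=> hp indH.
have [a [b [a0 b0 rab]]] := indefinite_jacobi_rank hp (hessian_sym sf P) indH.
have [x [xa xx]] := gform_prescribed f P eps a0.
have [y [yb yy]] := gform_prescribed f P eps b0.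
exists x, y; split=> // -[U uU /(similarRL uU) E].
move: rab; rewrite -xa -yb -[\rank (jacobi_form _ (lsubmx x))]mxrank_nilblock.
rewrite -[\rank (jacobi_form _ (lsubmx y))]mxrank_nilblock -!jacobiWE// E.
move=> /eqP; apply.
by rewrite mxrankMfree ?row_free_unit ?unitmx_inv// eqmxMfull// row_full_unit.
Qed.

(** A combination with zero x-part is null, whereas its norm is (s^2 + t^2) eps. *)
Lemma orthonormal_lsubmx_free P eps e1 e2 (s t : R) : eps != 0 ->
  orthonormal_pair G P eps e1 e2 ->
  s *: lsubmx e1 + t *: lsubmx e2 = 0 -> s = 0 /\ t = 0.
Proof.
move=> eps0 on st0.
have symG : (G P)^T = G P.
  by rewrite metric_gfE tr_block_mx trmx_mul trmxK trmx1 trmx0.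
have /eqP := gform_combination s t symG on.
rewrite gform_lsubmx0 ?linearD ?linearZ//= eq_sym mulf_eq0 (negPf eps0) orbF.
by rewrite paddr_eq0 ?sqr_ge0// !sqrf_eq0 => /andP[/eqP -> /eqP ->].
Qed.

Lemma mxrank_weylPlane P eps e1 e2 : H_nondegenerate (hessian f P) ->
  eps != 0 -> orthonormal_pair G P eps e1 e2 ->
  \rank (weylPlane G P e1 e2) = 2%N.
Proof.
move=> uH eps0 on; rewrite weylPlaneE// mxrank_nilblock mxrank_plane_form//.
by move=> s t; exact: orthonormal_lsubmx_free on.
Qed.

Lemma nondegenerate_jordan_ivanov_petrova (eps : R) P e1 e2 f1 f2 :
  H_nondegenerate (hessian f P) -> eps != 0 ->
  orthonormal_pair G P eps e1 e2 -> orthonormal_pair G P eps f1 f2 ->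
  same_jordan_form (weylPlane G P e1 e2) (weylPlane G P f1 f2).
Proof.
move=> uH eps0 one onf; rewrite /same_jordan_form !weylPlaneE//.
have rk u v : orthonormal_pair G P eps u v ->
    \rank (plane_form (hessian f P) (lsubmx u) (lsubmx v)) = 2%N.
  move=> on; rewrite -mxrank_nilblock -weylPlaneE//.
  exact: mxrank_weylPlane on.
by apply: similar_nilblock; rewrite !rk.
Qed.

End JordanType.

Theorem theorem4p1 (R : realType) (p : nat) (hp : (3 <= p)%N)
  (f : 'rV[R]_p -> R) (hf : smooth f) :
  (* (1) *)
  ((forall P : 'rV[R]_(p + p), H_definite (hessian f P) ->
      forall x : 'rV[R]_(p + p), gform (metric_gf f) P x x != 0 ->
        \rank (jacobiW (metric_gf f) P x) = p.-1 /\
        jacobiW (metric_gf f) P x *m jacobiW (metric_gf f) P x = 0) /\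
   ((forall P : 'rV[R]_(p + p), H_definite (hessian f P)) ->
      conf_spacelike_JO (metric_gf f) /\ conf_timelike_JO (metric_gf f))) /\
  (* (2) *)
  (forall P : 'rV[R]_(p + p), H_indefinite (hessian f P) ->
      ~ conf_spacelike_JO (metric_gf f) /\ ~ conf_timelike_JO (metric_gf f)) /\
  (* (3) *)
  ((forall P : 'rV[R]_(p + p), H_nondegenerate (hessian f P) ->
      forall (eps : R) (e1 e2 : 'rV[R]_(p + p)), (eps = 1 \/ eps = -1) ->
        orthonormal_pair (metric_gf f) P eps e1 e2 ->
        \rank (weylPlane (metric_gf f) P e1 e2) = 2%N /\
        weylPlane (metric_gf f) P e1 e2 *m weylPlane (metric_gf f) P e1 e2 = 0) /\
   ((forall P : 'rV[R]_(p + p), H_nondegenerate (hessian f P)) ->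
      conf_spacelike_JIP (metric_gf f) /\ conf_timelike_JIP (metric_gf f))).
Proof.
have N10 : (-1 : R) != 0 by rewrite oppr_eq0 oner_eq0.
split; [split|split; [|split]].
- move=> P defH x xx; split; first exact: mxrank_jacobiW_definite.
  by rewrite jacobiWE// mulmx_nilblock.
- move=> defH; split=> P x y.
  + exact: (definite_jordan_osserman hf (defH P) (oner_neq0 R)).
  + exact: (definite_jordan_osserman hf (defH P) N10).
- move=> P indH; split=> JO.
  + have [x [y [xx yy]]] := indefinite_not_jordan_osserman hf 1 hp indH.
    by apply; exact: JO.
  + have [x [y [xx yy]]] := indefinite_not_jordan_osserman hf (-1) hp indH.
    by apply; exact: JO.
- move=> P uH eps e1 e2 eps1 on.
  have eps0 : eps != 0 by case: eps1 => ->; rewrite ?oner_eq0.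
  by rewrite (mxrank_weylPlane hf uH eps0 on) weylPlaneE// mulmx_nilblock.
- move=> uH; split=> P e1 e2 f1 f2.
  + exact: (nondegenerate_jordan_ivanov_petrova hf (uH P) (oner_neq0 R)).
  + exact: (nondegenerate_jordan_ivanov_petrova hf (uH P) N10).
Qed.
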